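(* Let $k$ be a field of characteristic zero and $n\ge 1$. The invariant integral on the special linear group $Sl_n$, regarded as a linear form on $k[x_{11},\ldots,x_{nn}]$ vanishing on the ideal $(\det(x_{ij})-1)$, is $$w_{Sl_n}=\sum_{i\ge 0}\frac{D_0^i}{D_0^i(\det^i(x_{ij}))}.$$
   Context: $A_{Sl_n}=k[x_{11},\ldots,x_{nn}]/(\det(x_{ij})-1)$ is the ring of functions of $Sl_n$. The invariant integral $w_{Sl_n}\in A_{Sl_n}^*={\rm Hom}_k(A_{Sl_n},k)$ is the unique $Sl_n$-invariant linear form with $w_{Sl_n}(1)=1$. One has an inclusion $A_{Sl_n}^*\subset k[x_{11},\ldots,x_{nn}]^*$ as the linear forms vanishing on $(\det(x_{ij})-1)$. $D=\det\left(\frac{\partial}{\partial x_{ij}}\right)$ is the Cayley operator, a differential operator on $k[x_{11},\ldots,x_{nn}]$, and $D_0^i=D^i|_0$ is the linear form $p\mapsto (D^ip)(0)$ (so $D_0^0$ is evaluation at the zero matrix). The infinite sum makes sense because on each polynomial only finitely many terms are nonzero. *)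

(* Defs.v *)
From HB Require Import structures.
From mathcomp Require Import all_boot all_order all_algebra all_fingroup.
From mathcomp Require Import mpoly.

Set Implicit Arguments.
Unset Strict Implicit.
Unset Printing Implicit Defensive.

Import GRing.Theory.
Local Open Scope ring_scope.

(* The ring k[x_11, ..., x_nn] is {mpoly k[n * n]}; the variable x_ij is the
   variable of index mxvec_index i j. *)
Definition varmx (R : comNzRingType) (n : nat) : 'M[{mpoly R[n * n]}]_n :=
  \matrix_(i, j) 'X_(mxvec_index i j).

Definition subst_mx (R : comNzRingType) (n : nat)
    (M : 'M[{mpoly R[n * n]}]_n) (p : {mpoly R[n * n]}) : {mpoly R[n * n]} :=
  p \mPo [tuple mxvec M 0 l | l < n * n].

(* q(x) |-> q(g x) and q(x) |-> q(x g), for g a matrix over R. *)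
Definition ltrans (R : comNzRingType) (n : nat) (g : 'M[R]_n) :=
  subst_mx (map_mx (@mpolyC (n * n) R) g *m varmx R n).
Definition rtrans (R : comNzRingType) (n : nat) (g : 'M[R]_n) :=
  subst_mx (varmx R n *m map_mx (@mpolyC (n * n) R) g).

(* The R-linear extension R[x_11, ..., x_nn] -> R of a linear form on
   k[x_11, ..., x_nn]. *)
Definition base_change (k : fieldType) (n : nat)
    (w : {scalar {mpoly k[n * n]}}) (R : comAlgType k)
    (q : {mpoly R[n * n]}) : R :=
  \sum_(m <- msupp q) w 'X_[m] *: q@_m.

(* The linear forms on k[x_11, ..., x_nn] that vanish on the ideal
   (det(x_ij) - 1), that is, the elements of the dual of A_{Sl_n}. *)
Definition SL_form (k : fieldType) (n : nat) (w : {scalar {mpoly k[n * n]}}) :=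
  forall p : {mpoly k[n * n]}, w (p * (\det (varmx k n) - 1)) = 0.

(* Invariance is meant for the group scheme Sl_n: under Sl_n(R), for every
   commutative k-algebra R. The zero algebra, which is not a comAlgType, would
   add nothing. *)
Definition SL_left_invariant (k : fieldType) (n : nat)
    (w : {scalar {mpoly k[n * n]}}) :=
  forall (R : comAlgType k) (g : 'M[R]_n) (q : {mpoly R[n * n]}),
    \det g = 1 -> base_change w (ltrans g q) = base_change w q.

Definition SL_right_invariant (k : fieldType) (n : nat)
    (w : {scalar {mpoly k[n * n]}}) :=
  forall (R : comAlgType k) (g : 'M[R]_n) (q : {mpoly R[n * n]}),
    \det g = 1 -> base_change w (rtrans g q) = base_change w q.

(* det(d/dx_ij), expanded over permutations; the product of differential
   operators is composition. *)
Definition cayley (k : fieldType) (n : nat) (p : {mpoly k[n * n]}) :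
    {mpoly k[n * n]} :=
  \sum_(s : 'S_n) (-1) ^+ s *:
    (\big[comp/id]_(i < n) mderiv (mxvec_index i (s i))) p.

Definition cayley0 (k : fieldType) (n i : nat) (p : {mpoly k[n * n]}) : k :=
  (iter i (@cayley k n) p).@[fun=> 0].

(* w is the sum of the forms u i, only finitely many of which are nonzero on
   any given vector. *)
Definition is_locally_finite_sum (k : fieldType) (V : Type)
    (u : nat -> V -> k) (w : V -> k) :=
  forall p : V, exists N : nat,
    (forall i, (N <= i)%N -> u i p = 0) /\ w p = \sum_(i < N) u i p.

(* Main.v *)
Require Import Defs.
From HB Require Import structures.
From mathcomp Require Import all_boot all_order all_algebra all_fingroup.
From mathcomp Require Import ssrcomplements mpoly.

Set Implicit Arguments.
Unset Strict Implicit.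
Unset Printing Implicit Defensive.

Import Order.TTheory GRing.Theory Num.Theory.
Local Open Scope ring_scope.

(** Write Delta for the determinant of the generic matrix and D for the Cayley
operator. Everything rests on the Fischer pairing, the symmetric bilinear form
<f, g> = sum_m m! f_m g_m, which is (f(d/dx) g)(0). Multiplication by a variable
is adjoint to the derivative in it, so multiplication by Delta is adjoint to D
([cayley_adjoint]) and D^i p evaluated at 0 is <Delta^i, p>
([cayley0_fischer]). A linear substitution is adjoint to the transposed one
([fischer_ltrans], [fischer_rtrans]). The rest follows from these adjunctions.

- The constant c_i = <Delta^i, Delta^i> is the image of a sum of positive
  integers, hence nonzero in characteristic 0 ([cayley_const_neq0]).
- The form p |-> <Delta^i, p> is invariant under every matrix of determinant 1,
  over every commutative k-algebra, because Delta^i is invariant under the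
  transposed matrix. So is the sum w of these forms divided by the c_i.
- The adjunctions make h = D Delta^(i+1) satisfy h(g x) = det(g)^i h(x) for
  invertible g. At x = 1 this says that h is a multiple of Delta^i, and the
  factor is c_(i+1) / c_i ([cayley_det]): a Cayley identity with its constant
  in terms of values at 0. Hence <Delta^(i+1), p Delta> / c_(i+1) = <Delta^i, p> / c_i,
  and, <1, p Delta> being 0, the sum for p Delta is the sum for p: the form w
  vanishes on the ideal of Delta - 1.

Uniqueness is the usual exchange of averages: a left invariant normalised form
w and a right invariant one w' coincide, for applying w in y and w' in x to
p(x y) gives both w(p) and w'(p) ([left_right_invariant_eq]). Since w above is
invariant on both sides, it can play either role. The coordinate ring of Sl_n
is never formed: a polynomial whose value at x depends only on det x is
constant modulo Delta - 1 ([SL_form_restriction]), and identities between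
polynomials are checked at points, which suffices as k is infinite
([mxeval_inj_GL]). *)

(** * Linear forms and the Fischer pairing *)

(** Induction along the generation of the polynomial ring by constants, sums and
multiplication by one variable, the operation whose adjoint is a derivative. *)
Lemma mpoly_ind_mulX (N : nat) (R : comNzRingType) (P : {mpoly R[N]} -> Prop) :
    (forall c, P c%:MP) -> (forall p q, P p -> P q -> P (p + q)) ->
    (forall i p, P p -> P ('X_i * p)) ->
  forall p, P p.
Proof.
move=> PC PD PX; elim/mpolyind => [|c m p _ _ Pp]; first by rewrite -mpolyC0.
apply: PD => //; rewrite -mul_mpolyC mulrC mpolyXE_id.
pose Q (x : {mpoly R[N]}) := forall p, P p -> P (x * p).
suff: Q (\prod_(i < N) 'X_i ^+ m i) by apply.
apply: big_ind => [q|x y Qx Qy q Pq|i _]; rewrite /Q ?mul1r // -?mulrA.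
  exact/Qx/Qy.
elim: (m i) => [|d IHd] q Pq; first by rewrite mul1r.
by rewrite exprS -mulrA; apply/PX/IHd.
Qed.

Section LinearExtension.
Variables (N : nat) (R : comNzRingType) (phi : 'X_{1..N} -> R).

Definition mlinext (p : {mpoly R[N]}) : R :=
  \sum_(m <- msupp p) p@_m * phi m.

(** A common degree bound replaces the supports, which do not add up. *)
Lemma mlinextwE d p : (msize p <= d)%N ->
  mlinext p = \sum_(m : 'X_{1..N < d}) p@_m * phi m.
Proof.
move=> le_pd; rewrite /mlinext (big_mksub ('X_{1..N < d} : subFinType _)) /=.
- by rewrite big_rmcond //= => m /memN_msupp_eq0 ->; rewrite mul0r.
- exact: msupp_uniq.
- by move=> m /msize_mdeg_lt/leq_trans; apply.
Qed.

Lemma mlinext_is_linear : linear_for *%R mlinext.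
Proof.
move=> c p q.
pose d := maxn (msize (c *: p + q)) (maxn (msize p) (msize q)).
rewrite !(@mlinextwE d) ?leq_maxl //; last 2 first.
- by rewrite leq_max leq_maxr orbT.
- by rewrite leq_max leq_maxl orbT.
rewrite mulr_sumr -big_split /=; apply: eq_bigr => m _.
by rewrite mcoeffD mcoeffZ mulrDl mulrA.
Qed.

HB.instance Definition _ :=
  GRing.isLinear.Build R {mpoly R[N]} R *%R mlinext mlinext_is_linear.

Lemma mlinextX m : mlinext 'X_[m] = phi m.
Proof. by rewrite /mlinext msuppX big_seq1 mcoeffX eqxx mul1r. Qed.

End LinearExtension.

Definition mnmfact (N : nat) (m : 'X_{1..N}) : nat := (\prod_(i < N) (m i)`!)%N.

Lemma mnmfact_gt0 N (m : 'X_{1..N}) : (0 < mnmfact m)%N.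
Proof. by apply: prodn_gt0 => i; apply: fact_gt0. Qed.

Lemma mnmfact0 N : mnmfact (0 : 'X_{1..N})%MM = 1%N.
Proof. by apply: big1 => i _; rewrite mnm0E. Qed.

Lemma mnmfactDU N i (m : 'X_{1..N}) :
  mnmfact (U_(i) + m) = ((m i).+1 * mnmfact m)%N.
Proof.
rewrite /mnmfact (bigD1 i) //= [in RHS](bigD1 i) //= mulnA.
rewrite mnmDE mnm1E eqxx add1n factS; congr (_ * _)%N.
by apply: eq_bigr => j nij; rewrite mnmDE mnm1E eq_sym (negPf nij).
Qed.

Section Fischer.
Variables (N : nat) (R : comNzRingType).
Implicit Types f g p q : {mpoly R[N]}.

(** The Fischer, or apolar, pairing: f acts on g as a differential operator with
constant coefficients and the result is evaluated at 0. *)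
Definition fischer f : {mpoly R[N]} -> R :=
  mlinext (fun m => f@_m *+ mnmfact m).

HB.instance Definition _ f := GRing.Linear.on (fischer f).

Lemma fischerX f m : fischer f 'X_[m] = f@_m *+ mnmfact m.
Proof. exact: mlinextX. Qed.

Lemma fischerC f g : fischer f g = fischer g f.
Proof.
pose d := maxn (msize f) (msize g).
rewrite /fischer !(@mlinextwE _ _ _ d) ?leq_maxl ?leq_maxr //.
by apply: eq_bigr => m _; rewrite !mulrnAr mulrC.
Qed.

Lemma fischer_const f c : fischer f c%:MP = c * f@_0.
Proof.
by rewrite -[c%:MP]mulr1 mul_mpolyC linearZ /= -mpolyX0 fischerX mnmfact0.
Qed.

Lemma fischer_mulX f g i : fischer f ('X_i * g) = fischer f^`M(i) g.
Proof.
elim/mpolyind: g => [|c m g _ _ IH]; first by rewrite mulr0 !raddf0.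
rewrite mulrDr !raddfD /= {}IH; congr (_ + _).
rewrite -scalerAr !linearZ /= -mpolyXD !fischerX mnmfactDU mcoeff_mderiv.
by rewrite -mulrnA addmC.
Qed.

End Fischer.

Lemma fischer_map (N : nat) (R S : comNzRingType) (f : {rmorphism R -> S})
    (p q : {mpoly R[N]}) :
  fischer (map_mpoly f p) (map_mpoly f q) = f (fischer p q).
Proof.
elim/mpolyind: q => [|c m q _ _ IH]; first by rewrite !raddf0.
rewrite !raddfD /= IH; congr (_ + _).
rewrite map_mpolyZ map_mpolyX !linearZ /= rmorphM /= !fischerX.
by rewrite mcoeff_map_mpoly rmorphMn.
Qed.

(** In characteristic 0 the factorials weighting the coefficients are
invertible. *)
Lemma fischer_nondegenerate (k : fieldType) (N : nat) (p : {mpoly k[N]}) :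
  [pchar k] =i pred0 -> (forall q, fischer p q = 0) -> p = 0.
Proof.
move=> /pcharf0P char0 p0; apply/mpolyP => m; rewrite mcoeff0.
have /eqP := p0 'X_[m]; rewrite fischerX -mulr_natr mulf_eq0 char0.
by rewrite [(mnmfact m == 0)%N]gtn_eqF ?mnmfact_gt0 // orbF => /eqP.
Qed.

Lemma mderivXU (N : nat) (R : comNzRingType) (i j : 'I_N) :
  ('X_i : {mpoly R[N]})^`M(j) = (i == j)%:R.
Proof.
rewrite mderivX mnm1E; case: eqP => [->|_]; last by rewrite scale0r.
by rewrite scale1r -{1}[U_(j)%MM]add0m addmK mpolyX0.
Qed.

(** Stated for an arbitrary derivation d that kills constants: d is a partial
derivative in the adjunction of linear substitutions, and the derivative of a
univariate polynomial in the restriction to a line. *)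
Lemma chain_rule (N : nat) (R S : comNzRingType) (f : {rmorphism R -> S})
    (h : 'I_N -> S) (d : {additive S -> S}) :
    (forall a b, d (a * b) = d a * b + a * d b) -> (forall c, d (f c) = 0) ->
  forall p : {mpoly R[N]},
    d (mmap f h p) = \sum_j mmap f h p^`M(j) * d (h j).
Proof.
move=> dM dC; elim/mpoly_ind_mulX => [c|p q IHp IHq|i p IH].
- rewrite mmapC dC big1 // => j _.
  by rewrite mderivC mmap0 mul0r.
- rewrite mmapD raddfD /= IHp IHq -big_split /=; apply: eq_bigr => j _.
  by rewrite mderivD mmapD mulrDl.
- rewrite rmorphM /= mmapX mmap1U dM IH [X in _ + X]mulr_sumr.
  under [RHS]eq_bigr => j _ do
    rewrite mderivM mmapD !rmorphM /= mmapX mmap1U mulrDl -mulrA.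
  rewrite big_split /=; congr (_ + _); last first.
    by apply: eq_bigr => j _; rewrite mulrA.
  rewrite [RHS](bigD1 i) //= [X in _ + X]big1 ?addr0 => [|j nij].
    by rewrite mderivXU eqxx rmorph_nat mul1r mulrC.
  by rewrite mderivXU eq_sym (negPf nij) rmorph_nat mul0r.
Qed.

(** By induction on f. Multiplying f by 'X_i multiplies the left substitution by
the linear form t_i, whose adjoint is the corresponding combination of
derivatives; by the chain rule that is the derivative in 'X_i of the right
substitution. *)
Lemma fischer_comp (N : nat) (R : comNzRingType) (A : 'M[R]_N)
    (t t' : N.-tuple {mpoly R[N]}) (f g : {mpoly R[N]}) :
    (forall i, tnth t i = \sum_j A i j *: 'X_j) ->
    (forall i, tnth t' i = \sum_j A j i *: 'X_j) ->
  fischer (f \mPo t) g = fischer f (g \mPo t').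
Proof.
move=> tE t'E.
elim/mpoly_ind_mulX: f g => [c|p q IHp IHq|i p IH] g.
- rewrite comp_mpolyC !(fischerC c%:MP) !fischer_const; congr (_ * _).
  elim/mpoly_ind_mulX: g => [b|p q IHp IHq|i p IH].
  + by rewrite comp_mpolyC.
  + by rewrite comp_mpolyD !mcoeffD IHp IHq.
  + have t'0 : (tnth t' i)@_0 = 0.
      rewrite t'E raddf_sum /= big1 // => j _.
      by rewrite mcoeffZ mcoeffX mnm1_eq0 mulr0.
    rewrite !rmorphM /= [_ \mPo _ in RHS]mmapX mmap1U t'0.
    by rewrite mcoeffX mnm1_eq0 !mul0r.
- by rewrite raddfD /= !(fischerC (_ + _)) !raddfD /= !(fischerC g)
     !(fischerC (g \mPo t')) IHp IHq.
- have dt' j : (tnth t' j)^`M(i) = (A i j)%:MP.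
    rewrite t'E raddf_sum /= (bigD1 i) //= big1 => [|l nli].
      by rewrite addr0 mderivZ mderivXU eqxx -mul_mpolyC mulr1.
    by rewrite mderivZ mderivXU (negPf nli) scaler0.
  rewrite rmorphM /= [X in X * _]mmapX mmap1U tE fischerC mulr_suml raddf_sum.
  rewrite /= [RHS]fischerC fischer_mulX.
  rewrite (chain_rule (d := mderiv i) _ (@mderivM _ _ _) (@mderivC _ _ _)).
  rewrite [RHS]fischerC raddf_sum /=; apply: eq_bigr => j _.
  rewrite -scalerAl linearZ /= fischer_mulX fischerC IH dt'.
  by rewrite [_ * _%:MP]mulrC mul_mpolyC linearZ.
Qed.

(** * Substitutions by matrices *)

Section Points.
Variables (n : nat) (R : comNzRingType).
Implicit Types (x y g : 'M[R]_n) (p : {mpoly R[n * n]}).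

Definition mxeval x p : R := p.@[fun l => mxvec x 0 l].

HB.instance Definition _ x :=
  GRing.RMorphism.copy (mxeval x) (meval (fun l => mxvec x 0 l)).
HB.instance Definition _ x :=
  GRing.Linear.copy (mxeval x) (meval (fun l => mxvec x 0 l)).

Lemma mxevalC x c : mxeval x c%:MP = c. Proof. exact: mevalC. Qed.

Lemma mxevalX x i j : mxeval x 'X_(mxvec_index i j) = x i j.
Proof. by rewrite /mxeval mevalXU mxvecE. Qed.

Lemma mxeval_varmx x : map_mx (mxeval x) (varmx R n) = x.
Proof. by apply/matrixP => i j; rewrite !mxE mxevalX. Qed.

Lemma mxeval_constmx x g : map_mx (mxeval x) (map_mx (@mpolyC (n * n) R) g) = g.
Proof. by apply/matrixP => i j; rewrite !mxE mxevalC. Qed.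

Lemma mxeval_det x : mxeval x (\det (varmx R n)) = \det x.
Proof. by rewrite -det_map_mx mxeval_varmx. Qed.

Lemma mxeval_subst x M p :
  mxeval x (subst_mx M p) = mxeval (map_mx (mxeval x) M) p.
Proof.
rewrite /subst_mx /mxeval comp_mpoly_meval; apply: meval_eq => l.
by rewrite tnth_mktuple -map_mxvec mxE.
Qed.

Lemma mxeval_ltrans x g p : mxeval x (ltrans g p) = mxeval (g *m x) p.
Proof.
by rewrite mxeval_subst map_mxM mxeval_constmx mxeval_varmx.
Qed.

Lemma mxeval_rtrans x g p : mxeval x (rtrans g p) = mxeval (x *m g) p.
Proof.
by rewrite mxeval_subst map_mxM mxeval_constmx mxeval_varmx.
Qed.

HB.instance Definition _ M := GRing.RMorphism.copy (@subst_mx R n M)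
  (comp_mpoly [tuple mxvec M 0 l | l < n * n]).
HB.instance Definition _ M := GRing.Linear.copy (@subst_mx R n M)
  (comp_mpoly [tuple mxvec M 0 l | l < n * n]).
HB.instance Definition _ g := GRing.RMorphism.copy (ltrans g)
  (subst_mx (map_mx (@mpolyC (n * n) R) g *m varmx R n)).
HB.instance Definition _ g := GRing.Linear.copy (ltrans g)
  (subst_mx (map_mx (@mpolyC (n * n) R) g *m varmx R n)).
HB.instance Definition _ g := GRing.RMorphism.copy (rtrans g)
  (subst_mx (varmx R n *m map_mx (@mpolyC (n * n) R) g)).
HB.instance Definition _ g := GRing.Linear.copy (rtrans g)
  (subst_mx (varmx R n *m map_mx (@mpolyC (n * n) R) g)).

Lemma subst_mxX (M : 'M[{mpoly R[n * n]}]_n) i j :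
  subst_mx M 'X_(mxvec_index i j) = M i j.
Proof. by rewrite /subst_mx /comp_mpoly mmapX mmap1U tnth_mktuple mxvecE. Qed.

Lemma subst_mx_varmx (M : 'M[{mpoly R[n * n]}]_n) :
  map_mx (@subst_mx R n M) (varmx R n) = M.
Proof. by apply/matrixP => i j; rewrite !mxE subst_mxX. Qed.

Lemma ltrans_det g :
  ltrans g (\det (varmx R n)) = \det g *: \det (varmx R n).
Proof.
rewrite -det_map_mx subst_mx_varmx det_mulmx det_map_mx.
by rewrite mul_mpolyC.
Qed.

Lemma rtrans_det g :
  rtrans g (\det (varmx R n)) = \det g *: \det (varmx R n).
Proof.
rewrite -det_map_mx subst_mx_varmx det_mulmx det_map_mx.
by rewrite mulrC mul_mpolyC.
Qed.

Lemma ltransX g i j :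
  ltrans g 'X_(mxvec_index i j) = \sum_a g i a *: 'X_(mxvec_index a j).
Proof.
rewrite /ltrans subst_mxX mxE; apply: eq_bigr => a _.
by rewrite !mxE mul_mpolyC.
Qed.

Lemma rtransX g i j :
  rtrans g 'X_(mxvec_index i j) = \sum_b g b j *: 'X_(mxvec_index i b).
Proof.
rewrite /rtrans subst_mxX mxE; apply: eq_bigr => b _.
by rewrite !mxE mulrC mul_mpolyC.
Qed.

Lemma sum_mxvec (V : nmodType) (F : 'I_(n * n) -> V) :
  \sum_l F l = \sum_i \sum_j F (mxvec_index i j).
Proof.
rewrite pair_bigA /= (reindex _ (curry_mxvec_bij n n)) /=.
by apply: eq_bigr => -[].
Qed.

Lemma eq_mxvec_index (i j a b : 'I_n) :
  (mxvec_index i j == mxvec_index a b) = (i == a) && (j == b).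
Proof.
have [f fK _] := curry_mxvec_bij n n.
have idxK u : f (mxvec_index u.1 u.2) = u by case: u => c d; rewrite -[RHS]fK.
rewrite -[RHS]xpair_eqE; apply/eqP/eqP => [|[-> ->]] // /(congr1 f).
by rewrite (idxK (i, j)) (idxK (a, b)).
Qed.

(** On n * n variables, the transpose of left multiplication by g is left
multiplication by the transpose of g. *)
Lemma fischer_ltrans g f h :
  fischer (ltrans g f) h = fischer f (ltrans g^T h).
Proof.
(* The matrix of the substitution, as an endomorphism of the linear forms. *)
pose A := \matrix_(l, m) (ltrans g 'X_l)@_(U_(m)).
have AE i j a b : A (mxvec_index i j) (mxvec_index a b) = g i a *+ (j == b).
  rewrite mxE ltransX raddf_sum /= (bigD1 a) //= big1 => [|c nca].
    by rewrite mcoeffZ mcoeffXU addr0 mulr_natr eq_mxvec_index eqxx.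
  by rewrite mcoeffZ mcoeffXU eq_mxvec_index (negPf nca) mulr0.
apply: (fischer_comp (A := A)) => l; case/mxvec_indexP: l => i j;
  rewrite tnth_mktuple mxvecE mxE sum_mxvec; apply: eq_bigr => a _.
- rewrite (bigD1 j) //= big1 => [|b nbj]; rewrite AE.
    by rewrite eqxx !mxE mul_mpolyC addr0.
  by rewrite eq_sym (negPf nbj) scale0r.
- rewrite (bigD1 j) //= big1 => [|b nbj]; rewrite AE.
    by rewrite eqxx !mxE mul_mpolyC addr0.
  by rewrite (negPf nbj) scale0r.
Qed.

Lemma fischer_rtrans g f h :
  fischer (rtrans g f) h = fischer f (rtrans g^T h).
Proof.
(* The matrix of the substitution, as an endomorphism of the linear forms. *)
pose A := \matrix_(l, m) (rtrans g 'X_l)@_(U_(m)).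
have AE i j a b : A (mxvec_index i j) (mxvec_index a b) = g b j *+ (i == a).
  rewrite mxE rtransX raddf_sum /= (bigD1 b) //= big1 => [|c ncb].
    by rewrite mcoeffZ mcoeffXU addr0 mulr_natr eq_mxvec_index eqxx andbT.
  by rewrite mcoeffZ mcoeffXU eq_mxvec_index (negPf ncb) andbF mulr0.
apply: (fischer_comp (A := A)) => l; case/mxvec_indexP: l => i j;
  rewrite tnth_mktuple mxvecE mxE sum_mxvec exchange_big; apply: eq_bigr => b _.
- rewrite (bigD1 i) //= big1 => [|a nai]; rewrite AE.
    by rewrite eqxx !mxE mulrC mul_mpolyC addr0.
  by rewrite eq_sym (negPf nai) scale0r.
- rewrite (bigD1 i) //= big1 => [|a nai]; rewrite AE.
    by rewrite eqxx !mxE mulrC mul_mpolyC addr0.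
  by rewrite (negPf nai) scale0r.
Qed.

End Points.

(** * The powers of the determinant *)

Lemma map_varmx (n : nat) (R S : comNzRingType) (f : {rmorphism R -> S}) :
  map_mx (map_mpoly f) (varmx R n) = varmx S n.
Proof. by apply/matrixP => i j; rewrite !mxE map_mpolyX. Qed.

Lemma map_detX (n i : nat) (R S : comNzRingType) (f : {rmorphism R -> S}) :
  map_mpoly f (\det (varmx R n) ^+ i) = \det (varmx S n) ^+ i.
Proof. by rewrite rmorphXn -det_map_mx map_varmx. Qed.

Lemma dhomog_detX (n i : nat) (R : comNzRingType) :
  \det (varmx R n) ^+ i \is (n * i).-homog.
Proof.
apply/dhomogMn/rpred_sum => s _; rewrite -signr_odd.
suff: \prod_j varmx R n j (s j) \is n.-homog.
  by case: (odd _); rewrite ?expr0 ?expr1 ?mul1r ?mulN1r ?rpredN.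
rewrite (eq_bigr (fun j => 'X_(mxvec_index j (s j)))) => [|j _];
  last exact: mxE.
rewrite mprodXE dhomogX /= mdeg_sum.
by under eq_bigr do rewrite mdeg1; rewrite sum1_card card_ord.
Qed.

(** * Polynomials vanishing at all points *)

Section CharZero.
Variable k : fieldType.
Hypothesis char0 : [pchar k] =i pred0.

Lemma poly_vanish (p : {poly k}) : (forall t, p.[t] = 0) -> p = 0.
Proof.
move=> p0; apply/eqP/negPn/negP => nzp.
pose rs := [seq i%:R : k | i <- iota 0 (size p)].
have := @max_poly_roots _ p rs nzp; rewrite size_map size_iota ltnn => H.
suff: false by []; apply: H; first by apply/allP => x _; apply/rootP.
rewrite map_inj_uniq ?iota_uniq // => i j.
wlog le_ij : i j / (i <= j)%N.
  by move=> W; case/orP: (leq_total i j) => /W // {}W /esym /W.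
move/esym/eqP; rewrite -subr_eq0 -natrB // ((pcharf0P _).1 char0) subn_eq0.
by move=> le_ji; apply/eqP; rewrite eqn_leq le_ij.
Qed.

(** The restriction of p to the line through v in direction i is a univariate
polynomial without nonzero value, so its derivative vanishes too. *)
Lemma vanish_mderiv (N : nat) (p : {mpoly k[N]}) (i : 'I_N) :
  (forall v, p.@[v] = 0) -> forall v, p^`M(i).@[v] = 0.
Proof.
move=> p0 v.
pose h j : {poly k} := (v j)%:P + (j == i)%:R * 'X.
have hE q t : (mmap polyC h q).[t] = q.@[fun j => v j + (j == i)%:R * t].
  elim/mpoly_ind_mulX: q => [c|q r IHq IHr|j q IH].
  - by rewrite mmapC mevalC hornerC.
  - by rewrite mmapD mevalD hornerD IHq IHr.
  - rewrite rmorphM mevalM hornerM IH /= mmapX mmap1U mevalXU; congr (_ * _).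
    by rewrite hornerD hornerC hornerM hornerX -polyC_natr hornerC.
have /poly_vanish hp0 : forall t, (mmap polyC h p).[t] = 0.
  by move=> t; rewrite hE p0.
have := chain_rule h (@derivM k) (@derivC k) p.
rewrite hp0 raddf0 /=.
move/(congr1 (horner^~ 0)); rewrite horner0 horner_sum (bigD1 i) //= big1.
  rewrite addr0 derivD derivC derivM derivX eqxx hornerM hE derivC mul0r mulr1.
  rewrite !add0r hornerC mulr1 => p'0; rewrite [RHS]p'0.
  by apply: meval_eq => j; rewrite mulr0 addr0.
move=> j nji; rewrite /h derivD derivC derivM derivX (negPf nji).
by rewrite derivC !mul0r !addr0 mulr0 horner0.
Qed.

Lemma meval0_mcoeff (N : nat) (p : {mpoly k[N]}) : p.@[fun=> 0] = p@_0.
Proof.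
elim/mpoly_ind_mulX: p => [c|p q IHp IHq|i p IH].
- by rewrite mevalC mpolyCK.
- by rewrite mevalD mcoeffD IHp IHq.
- by rewrite mevalM rmorphM /= mevalXU mcoeffX mnm1_eq0 !mul0r.
Qed.

(** If p vanishes everywhere, so do all its derivatives, hence p pairs to zero
with every monomial. *)
Lemma meval_inj0 (N : nat) (p : {mpoly k[N]}) :
  (forall v, p.@[v] = 0) -> p = 0.
Proof.
move=> p0; apply: (fischer_nondegenerate char0) => q.
elim/mpoly_ind_mulX: q p p0 => [c|q r IHq IHr|i q IH] p p0.
- by rewrite fischer_const -meval0_mcoeff p0 mulr0.
- by rewrite raddfD /= IHq ?IHr ?addr0.
- by rewrite fischer_mulX; apply/IH/vanish_mderiv.
Qed.

(** * The Cayley operator on powers of the determinant *)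

Section Matrices.
Variable n : nat.
Local Notation Delta := (\det (varmx k n)).
Implicit Types (x y g : 'M[k]_n) (p q f h : {mpoly k[n * n]}).

Lemma mxeval_inj p q : (forall x, mxeval x p = mxeval x q) -> p = q.
Proof.
move=> pq; apply/eqP; rewrite -subr_eq0; apply/eqP/meval_inj0 => v.
have <- : mxeval (vec_mx (\row_l v l)) (p - q) = (p - q).@[v].
  by apply: meval_eq => l; rewrite vec_mxK mxE.
by rewrite rmorphB /= pq subrr.
Qed.

(** Multiplying the difference by the determinant extends its vanishing from
invertible matrices to all of them. *)
Lemma mxeval_inj_GL p q :
  (forall x, \det x != 0 -> mxeval x p = mxeval x q) -> p = q.
Proof.
move=> pq; apply/eqP; rewrite -subr_eq0.
have nzD : Delta != 0.
  apply/eqP => /(congr1 (mxeval 1%:M)); rewrite mxeval_det det1 rmorph0.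
  by move/eqP; rewrite oner_eq0.
have /eqP : Delta * (p - q) = 0; last by rewrite mulf_eq0 (negPf nzD).
apply: mxeval_inj => x; rewrite rmorphM rmorphB rmorph0 /= mxeval_det.
by have [->|/pq ->] := eqVneq (\det x) 0; rewrite ?mul0r // subrr mulr0.
Qed.

Lemma cayley_adjoint p f : fischer p (Delta * f) = fischer (cayley p) f.
Proof.
rewrite /cayley /determinant mulr_suml raddf_sum /= [RHS]fischerC raddf_sum /=.
apply: eq_bigr => s _; rewrite [RHS]linearZ /= [in RHS]fischerC -mulrA.
rewrite -[(-1) ^+ s in LHS](rmorph_sign (@mpolyC (n * n) k)) mul_mpolyC.
rewrite linearZ; congr (_ * _) => /=.
under eq_bigr do rewrite mxE.
(* The first variable is moved next to f, to be the last to cross the pairing: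
   its derivative is then the outermost, as in the composite operator. *)
elim: (index_enum _) f => [|i r IH] f; first by rewrite !big_nil mul1r.
by rewrite !big_cons mulrAC [X in fischer p X = _]mulrC IH fischer_mulX.
Qed.

Lemma cayley0_fischer i p : cayley0 i p = fischer (Delta ^+ i) p.
Proof.
rewrite fischerC -[Delta ^+ i]mulr1 /cayley0 meval0_mcoeff.
elim: i p => [|i IH] p.
  by rewrite mul1r -[X in fischer _ X]mpolyC1 fischer_const mul1r.
by rewrite iterSr IH exprS -mulrA cayley_adjoint.
Qed.

Definition cayley_const i : k := cayley0 i (Delta ^+ i).

(** The pairing is positive definite over the integers, and Delta^i has integral
coefficients. *)
Lemma cayley_const_neq0 i : cayley_const i != 0.
Proof.
pose D : {mpoly int[n * n]} := \det (varmx int n) ^+ i.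
have -> : cayley_const i = (fischer D D)%:~R.
  by rewrite /cayley_const cayley0_fischer -(map_detX n i intr) fischer_map.
have nzD : D != 0.
  apply/eqP => /(congr1 (mxeval 1%:M)).
  by rewrite rmorphXn /= mxeval_det det1 expr1n rmorph0.
have: 0 < fischer D D.
  rewrite /fischer /mlinext.
  rewrite (big_rem (mlead D)) ?mlead_supp //=.
  have term_ge0 m : 0 <= D@_m * (D@_m *+ mnmfact m).
    by rewrite mulrnAr mulrn_wge0 // -expr2 sqr_ge0.
  apply: ltr_wpDr; first by apply: sumr_ge0.
  rewrite lt_def term_ge0 mulf_eq0 mulrn_eq0 mleadc_eq0 (negPf nzD) orbF.
  by rewrite gtn_eqF ?mnmfact_gt0.
case: (fischer D D) => // z; rewrite ltz_nat => z_gt0.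
by rewrite -pmulrn ((pcharf0P _).1 char0) -lt0n.
Qed.

(** The Cayley identity, with its constant expressed by the values at 0. By
adjunction both sides transform in the same way under left translation by
invertible matrices, so they are proportional. *)
Lemma cayley_det i :
  cayley (Delta ^+ i.+1) = (cayley_const i.+1 / cayley_const i) *: Delta ^+ i.
Proof.
set h := cayley _.
(* Pairing with f, both sides become equal after multiplication by det g: that
   factor turns Delta into its translate, and adjunction carries the translation
   over to Delta^(i+1). *)
have hg g : \det g != 0 -> ltrans g h = \det g ^+ i *: h.
  move=> nzg; apply/eqP; rewrite -subr_eq0; apply/eqP.
  apply: (fischer_nondegenerate char0) => f.
  rewrite fischerC raddfB /= linearZ /= !(fischerC f); apply/eqP.
  rewrite subr_eq0 -(inj_eq (mulfI nzg)) mulrA -exprS; apply/eqP.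
  rewrite fischer_ltrans -!cayley_adjoint -{1}(det_tr g).
  rewrite -[LHS]linearZ /= scalerAl -ltrans_det -rmorphM /= -fischer_ltrans.
  by rewrite rmorphXn /= ltrans_det exprZn fischerC linearZ /= fischerC.
(* The value of h at g is the value at the identity of its translate by g. *)
have hE : h = mxeval 1%:M h *: Delta ^+ i.
  apply: mxeval_inj_GL => x /hg /(congr1 (mxeval 1%:M)).
  rewrite mxeval_ltrans mulmx1 !linearZ /= rmorphXn /= mxeval_det => ->.
  by rewrite mulrC.
move: (mxeval _ h) hE => b hE; rewrite hE; congr (_ *: _).
apply: (canRL (mulfK (cayley_const_neq0 i))).
rewrite /cayley_const !cayley0_fischer [X in _ = fischer _ X]exprS.
by rewrite cayley_adjoint -/h hE [RHS]fischerC linearZ.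
Qed.

End Matrices.

End CharZero.

(** * Uniqueness of the invariant form *)

Section Uniqueness.
Variable k : fieldType.
Hypothesis char0 : [pchar k] =i pred0.
Variable n : nat.
Hypothesis n_gt0 : (0 < n)%N.
Local Notation Delta := (\det (varmx k n)).
Implicit Types (x y g : 'M[k]_n) (p q F : {mpoly k[n * n]}).

(** The matrix diag(d, 1, ..., 1): an invertible matrix differs from the one with
the same determinant by a factor of determinant 1, on either side. *)
Definition first_scaling (R : comNzRingType) (d : R) : 'M[R]_n :=
  diag_mx (\row_i (if val i == 0%N then d else 1)).

Lemma det_first_scaling (R : comNzRingType) (d : R) :
  \det (first_scaling d) = d.
Proof.
rewrite det_diag (bigD1 (Ordinal n_gt0)) //= big1 => [|i ni0]; rewrite !mxE /=.
  by rewrite mulr1.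
by rewrite ifN.
Qed.

Lemma mxeval_first_scaling x (P : {mpoly k[n * n]}) :
  map_mx (mxeval x) (first_scaling P) = first_scaling (mxeval x P).
Proof.
apply/matrixP => i j; rewrite !mxE rmorphMn /=.
by case: (val i == 0)%N; rewrite ?rmorph1.
Qed.

(** Modulo Delta - 1 the matrix diag(Delta, 1, ..., 1) is the identity. *)
Lemma subst_first_scaling_mod p :
  exists r, subst_mx (first_scaling Delta) p =
            (mxeval 1%:M p)%:MP + r * (Delta - 1).
Proof.
elim/mpoly_ind_mulX: p => [c|p q [r rE] [s sE]|l p [r rE]].
- by exists 0; rewrite mxevalC mul0r addr0 /subst_mx comp_mpolyC.
- by exists (r + s); rewrite !rmorphD /= rE sE mulrDl addrACA.
case/mxvec_indexP: l => i j; rewrite !rmorphM /= subst_mxX mxevalX rE.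
pose e : {mpoly k[n * n]} := ((val i == 0%N) && (i == j))%:R.
have -> : first_scaling Delta i j =
    ((1%:M : 'M[k]_n) i j)%:MP + e * (Delta - 1).
  rewrite !mxE /e; case: (val i == 0%N); case: (i == j);
  by rewrite /= ?mpolyC1 ?mpolyC0 ?mul1r ?mul0r ?addr0 // addrC subrK.
exists (((1%:M : 'M[k]_n) i j)%:MP * r +
  e * ((mxeval 1%:M p)%:MP + r * (Delta - 1))).
rewrite [LHS]mulrDl [X in X + _ = _]mulrDr -addrA; congr (_ + _).
by rewrite mulrA [e * _ * _]mulrAC -mulrDl.
Qed.

(** By density F is its own substitution at diag(Delta, 1, ..., 1), which is
constant modulo Delta - 1. *)
Lemma SL_form_restriction (w : {scalar {mpoly k[n * n]}}) F :
  SL_form w ->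
  (forall x, \det x != 0 ->
     mxeval x F = mxeval (first_scaling (\det x)) F) ->
  w F = mxeval 1%:M F * w 1.
Proof.
move=> wSL Fdet.
have {1}-> : F = subst_mx (first_scaling Delta) F.
  apply: mxeval_inj_GL => // x /Fdet ->.
  by rewrite mxeval_subst mxeval_first_scaling mxeval_det.
have [r ->] := subst_first_scaling_mod F.
by rewrite raddfD /= wSL addr0 -[_%:MP]mulr1 mul_mpolyC linearZ.
Qed.

(** The coproduct of p, that is p(x y) as a sum of products of a polynomial in x
and a polynomial in y. *)
Lemma comultiplication p :
  exists s : seq ({mpoly k[n * n]} * {mpoly k[n * n]}),
    forall x y, mxeval (x *m y) p = \sum_(u <- s) mxeval x u.1 * mxeval y u.2.
Proof.
elim/mpoly_ind_mulX: p => [c|p q [s sE] [t tE]|l p [s sE]].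
- exists [:: (c%:MP, 1)] => x y; rewrite big_seq1 /= rmorph1 mulr1.
  by rewrite !mxevalC.
- by exists (s ++ t) => x y; rewrite rmorphD /= sE tE big_cat.
case/mxvec_indexP: l => i j.
exists [seq ('X_(mxvec_index i a) * u.1, 'X_(mxvec_index a j) * u.2)
  | a <- enum 'I_n, u <- s] => x y.
rewrite rmorphM /= mxevalX sE mxE big_allpairs_dep /= big_enum /= mulr_suml.
apply: eq_bigr => a _; rewrite mulr_sumr; apply: eq_bigr => u _ /=.
by rewrite !rmorphM /= !mxevalX mulrACA.
Qed.

(** Invariance over [k^o], the field seen as an algebra over itself, is
invariance under the k-points of Sl_n. *)
Lemma base_change_regular (w : {scalar {mpoly k[n * n]}})
    (q : {mpoly k[n * n]}) :
  base_change w (q : {mpoly (k^o)[n * n]}) = w q.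
Proof.
rewrite [in RHS](mpolyE q) raddf_sum /=; apply: eq_bigr => m _.
by rewrite linearZ /= mulrC.
Qed.

Lemma SL_left_invariant_point (w : {scalar {mpoly k[n * n]}}) g p :
  SL_left_invariant w -> \det g = 1 -> w (ltrans g p) = w p.
Proof.
move=> wL g1; have := wL k^o g p g1.
by rewrite -(base_change_regular w p) -(base_change_regular w (ltrans g p)).
Qed.

Lemma SL_right_invariant_point (w : {scalar {mpoly k[n * n]}}) g p :
  SL_right_invariant w -> \det g = 1 -> w (rtrans g p) = w p.
Proof.
move=> wR g1; have := wR k^o g p g1.
by rewrite -(base_change_regular w p) -(base_change_regular w (rtrans g p)).
Qed.

Lemma ltransM g g' p : ltrans g' (ltrans g p) = ltrans (g *m g') p.
Proof.
apply: (mxeval_inj char0) => x.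
by rewrite 2![LHS]mxeval_ltrans [RHS]mxeval_ltrans mulmxA.
Qed.

Lemma rtransM g g' p : rtrans g' (rtrans g p) = rtrans (g' *m g) p.
Proof.
apply: (mxeval_inj char0) => x.
by rewrite 2![LHS]mxeval_rtrans [RHS]mxeval_rtrans mulmxA.
Qed.

(** Let F(x) be w applied to p(x y) in y and E(y) be w' applied to p(x y) in x.
Expanding the coproduct gives w'(F) = w(E). By left invariance of w the value
F(x) depends only on det x, so w'(F) = F(1) = w(p); symmetrically
w(E) = w'(p). *)
Lemma left_right_invariant_eq (w w' : {scalar {mpoly k[n * n]}}) :
  SL_form w -> SL_left_invariant w -> w 1 = 1 ->
  SL_form w' -> SL_right_invariant w' -> w' 1 = 1 ->
  w =1 w'.
Proof.
move=> wSL wL w1 w'SL w'R w'1 p.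
have [s sE] := comultiplication p.
have ltransE x : ltrans x p = \sum_(u <- s) mxeval x u.1 *: u.2.
  apply: (mxeval_inj char0) => y; rewrite mxeval_ltrans sE raddf_sum /=.
  by apply: eq_bigr => u _; rewrite linearZ.
have rtransE y : rtrans y p = \sum_(u <- s) mxeval y u.2 *: u.1.
  apply: (mxeval_inj char0) => x; rewrite mxeval_rtrans sE raddf_sum /=.
  by apply: eq_bigr => u _; rewrite linearZ mulrC.
pose F := \sum_(u <- s) w u.2 *: u.1.
pose E := \sum_(u <- s) w' u.1 *: u.2.
have FE x : mxeval x F = w (ltrans x p).
  rewrite ltransE !raddf_sum /=; apply: eq_bigr => u _.
  by rewrite !linearZ /= mulrC.
have EE y : mxeval y E = w' (rtrans y p).
  rewrite rtransE !raddf_sum /=; apply: eq_bigr => u _.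
  by rewrite !linearZ /= mulrC.
have w'F : w' F = w p.
  rewrite (SL_form_restriction w'SL) => [|x nzx]; rewrite !FE.
    rewrite w'1 mulr1; congr (w _).
    by apply: (mxeval_inj char0) => x; rewrite mxeval_ltrans mul1mx.
  pose d := first_scaling (\det x).
  have ud : d \in unitmx by rewrite unitmxE det_first_scaling unitfE.
  rewrite -{1}(mulKVmx ud x) -ltransM.
  rewrite [LHS]SL_left_invariant_point // det_mulmx det_inv det_first_scaling.
  by rewrite mulVf.
have wE : w E = w' p.
  rewrite (SL_form_restriction wSL) => [|x nzx]; rewrite !EE.
    rewrite w1 mulr1; congr (w' _).
    by apply: (mxeval_inj char0) => x; rewrite mxeval_rtrans mulmx1.
  pose d := first_scaling (\det x).
  have ud : d \in unitmx by rewrite unitmxE det_first_scaling unitfE.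
  rewrite -{1}(mulmxKV ud x) -rtransM.
  rewrite [LHS]SL_right_invariant_point // det_mulmx det_inv det_first_scaling.
  by rewrite mulfV.
rewrite -w'F -wE !raddf_sum /=; apply: eq_bigr => u _.
by rewrite !linearZ /= mulrC.
Qed.

End Uniqueness.

(** * The invariant integral *)

Section InvariantIntegral.
Variable k : fieldType.
Hypothesis char0 : [pchar k] =i pred0.
Variable n : nat.
Hypothesis n_gt0 : (0 < n)%N.
Local Notation Delta := (\det (varmx k n)).

(** On a monomial of degree d the terms with i > d vanish, so the sum over i is
truncated there and extended linearly. *)
Definition sl_integral : {mpoly k[n * n]} -> k :=
  mlinext (fun m => \sum_(i < (mdeg m).+1)
    cayley0 i ('X_[m] : {mpoly k[n * n]}) / cayley_const k n i).

HB.instance Definition _ := GRing.Linear.on sl_integral.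

(** Delta^i is homogeneous of degree n i, which is at least i. *)
Lemma fischer_detX_small (R : comNzRingType) i (q : {mpoly R[n * n]}) :
  (msize q <= i)%N -> fischer (\det (varmx R n) ^+ i) q = 0.
Proof.
move=> le_qi; apply: big1_seq => m /andP[_ /msize_mdeg_lt lt_mq].
rewrite (dhomog_nemf_coeff (dhomog_detX n i R)) ?mul0rn ?mulr0 //.
by rewrite ltn_eqF // (leq_trans lt_mq) // (leq_trans le_qi) // leq_pmull.
Qed.

Lemma sl_integralE N p : (msize p <= N)%N ->
  sl_integral p = \sum_(i < N) cayley0 i p / cayley_const k n i.
Proof.
move=> le_pN; under eq_bigr do
  rewrite cayley0_fischer [in fischer _ p](mpolyE p) raddf_sum mulr_suml.
rewrite exchange_big /=; apply: eq_big_seq => m /msize_mdeg_lt lt_mp.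
pose u i := cayley0 i ('X_[m] : {mpoly k[n * n]}) / cayley_const k n i.
rewrite (big_ord_widen N u) ?(leq_trans lt_mp) //.
rewrite big_mkcond mulr_sumr; apply: eq_bigr => i _; rewrite /u.
rewrite [in RHS]linearZ /= -mulrA cayley0_fischer ltnS; case: leqP => // lt_mi.
by rewrite fischer_detX_small ?msizeX // mul0r.
Qed.

(** Over an algebra R the extended form is the same sum of Fischer pairings,
because the coefficients of Delta^i over R come from k. *)
Lemma base_change_sl_integral (R : comAlgType k) N (q : {mpoly R[n * n]}) :
  (msize q <= N)%N ->
  base_change sl_integral q =
  \sum_(i < N) (cayley_const k n i)^-1 *: fischer (\det (varmx R n) ^+ i) q.
Proof.
move=> le_qN; rewrite /base_change.
under [RHS]eq_bigr do rewrite /fischer /mlinext scaler_sumr.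
rewrite exchange_big /=; apply: eq_big_seq => m /msize_mdeg_lt lt_mq.
rewrite (@sl_integralE N) ?msizeX ?(leq_trans lt_mq) // scaler_suml.
apply: eq_bigr => i _; rewrite cayley0_fischer fischerX.
rewrite -(map_detX n i (in_alg R)) mcoeff_map_mpoly /= mulrC -scalerA.
congr (_ *: _).
by rewrite -scalerMnl mulrnAr -scalerAr mulr1.
Qed.

Lemma sl_integral_left_invariant : SL_left_invariant sl_integral.
Proof.
move=> R g q g1; pose N := maxn (msize (ltrans g q)) (msize q).
rewrite !(@base_change_sl_integral R N) ?leq_maxl ?leq_maxr //.
apply: eq_bigr => i _.
rewrite -{1}(trmxK g) -fischer_ltrans rmorphXn /= ltrans_det.
by rewrite det_tr g1 scale1r.
Qed.

Lemma sl_integral_right_invariant : SL_right_invariant sl_integral.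
Proof.
move=> R g q g1; pose N := maxn (msize (rtrans g q)) (msize q).
rewrite !(@base_change_sl_integral R N) ?leq_maxl ?leq_maxr //.
apply: eq_bigr => i _.
rewrite -{1}(trmxK g) -fischer_rtrans rmorphXn /= rtrans_det.
by rewrite det_tr g1 scale1r.
Qed.

(** The term of index i + 1 at p Delta is the term of index i at p, by adjunction
and the Cayley identity, and the term of index 0 vanishes at p Delta. *)
Lemma sl_integral_SL_form : SL_form sl_integral.
Proof.
move=> p; rewrite mulrBr mulr1 raddfB /=.
pose N := maxn (msize (p * Delta)) (msize p).
rewrite (@sl_integralE N.+1) ?leqW ?leq_maxl // (@sl_integralE N) ?leq_maxr //.
have Delta0 : Delta@_0 = 0.
  rewrite -[LHS]mul1r -fischer_const mpolyC1 -[Delta]expr1.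
  by rewrite fischer_detX_small ?msize1.
rewrite big_ord_recl /= cayley0_fischer expr0 fischerC.
rewrite -[X in fischer _ X]mpolyC1 fischer_const rmorphM /= Delta0.
rewrite !mulr0 mul0r add0r; apply/eqP; rewrite subr_eq0; apply/eqP.
apply: eq_bigr => i _; rewrite mulrC.
rewrite cayley0_fischer [p * _]mulrC cayley_adjoint (cayley_det char0).
rewrite fischerC linearZ /= fischerC cayley0_fischer mulrA mulrC; congr (_ * _).
by rewrite mulrA mulVf ?mul1r // cayley_const_neq0.
Qed.

Lemma sl_integral1 : sl_integral 1 = 1.
Proof.
rewrite (@sl_integralE 1) ?msize1 // big_ord1 /cayley_const expr0 divff //.
exact: (cayley_const_neq0 char0 n 0).
Qed.

Lemma sl_integral_sum :
  is_locally_finite_sum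
    (fun i p => cayley0 i p / cayley0 i (Delta ^+ i)) sl_integral.
Proof.
move=> p; exists (msize p); split; last exact: sl_integralE.
by move=> i le_pi; rewrite cayley0_fischer fischer_detX_small ?mul0r.
Qed.

End InvariantIntegral.

Theorem mainTheorem6 (k : fieldType) (n : nat)
    (hk : [pchar k] =i pred0) (hn : (0 < n)%N) :
  (forall i : nat, cayley0 i (\det (varmx k n) ^+ i) != 0) /\
  exists w : {scalar {mpoly k[n * n]}},
    [/\ [/\ SL_form w, SL_left_invariant w, SL_right_invariant w & w 1 = 1],
        forall w' : {scalar {mpoly k[n * n]}},
          SL_form w' -> SL_left_invariant w' \/ SL_right_invariant w' ->
          w' 1 = 1 -> w' =1 w
      & is_locally_finite_sum
          (fun i p => cayley0 i p / cayley0 i (\det (varmx k n) ^+ i)) w].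
Proof.
split=> [i|]; first exact: (cayley_const_neq0 hk).
have SLw := sl_integral_SL_form hk hn.
have Lw := sl_integral_left_invariant hn (k := k).
have Rw := sl_integral_right_invariant hn (k := k).
have w1 := sl_integral1 hk hn.
exists (@sl_integral k n); split; last exact: sl_integral_sum.
  exact: And4 SLw Lw Rw w1.
move=> w' SLw' [Lw'|Rw'] w'1 p.
  exact: (left_right_invariant_eq hk hn SLw' Lw' w'1 SLw Rw w1).
exact/esym/(left_right_invariant_eq hk hn SLw Lw w1 SLw' Rw' w'1).
Qed.
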